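(* Let $p\in(0,1)$ be fixed and $q=1-p$. For all $\delta>0$ and all $\epsilon>0$ there is an integer $N$ such that for $G\in\mathcal B(m,n;p)$ \[\Pr\left[\sum_{A\in\mathcal A(G)}\frac{|A\cap L(G)|}{|\mathcal A(G)|}\le\left(\tfrac12+\delta\right)m\right]\ge1-\epsilon\] for all positive integers $m,n$ with $m+n\ge N$ and $n\ge\max\{20,(\lceil3\log_{1/q}(2)\rceil+2)^2\}+1$.
   Context: A random bipartite graph $G\in\mathcal B(m,n;p)$ has bipartition classes $L(G)$ of size $m$ and $R(G)$ of size $n$, each pair $u\in L(G)$, $v\in R(G)$ being joined by an edge independently with probability $p$. A vertex set is stable if no two of its vertices are adjacent, and maximally stable if moreover every vertex outside it has a neighbour in it. $\mathcal A(G)$ denotes the set of maximal stable sets of $G$. *)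

(* Defs.v *)
From mathcomp Require Import all_boot all_order all_algebra.
From mathcomp Require Import reals exp bernoulli_distribution.

Set Implicit Arguments.
Unset Strict Implicit.
Unset Printing Implicit Defensive.

Import Order.TTheory GRing.Theory Num.Theory.

Local Open Scope ring_scope.

Section StableSets.
Variables (T : finType) (e : rel T).

Definition stable_set (A : {set T}) : bool :=
  [forall x in A, forall y in A, ~~ e x y].

Definition max_stable_set (A : {set T}) : bool :=
  stable_set A && [forall x in ~: A, exists y in A, e x y].

Definition max_stable_sets : {set {set T}} := [set A | max_stable_set A].

End StableSets.

(* A bipartite graph with ordered classes of sizes m and n is encoded by the
   set of pairs (u, v) of adjacent left and right vertices. *)
Definition bigraph (m n : nat) : finType := {set 'I_m * 'I_n}.

Definition bigraph_adj (m n : nat) (G : bigraph m n) : rel ('I_m + 'I_n) :=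
  fun x y => match x, y with
  | inl u, inr v => (u, v) \in G
  | inr v, inl u => (u, v) \in G
  | _, _ => false
  end.

Definition left_class (m n : nat) : {set 'I_m + 'I_n} :=
  [set inl u | u : 'I_m].

(* Probability of an event in B(m, n; p): as the pairs are joined
   independently, the weight of a graph is the product over all pairs of the
   Bernoulli(p) weight of that pair being joined or not. *)
Definition bigraph_Pr (R : realType) (m n : nat) (p : R)
    (E : pred (bigraph m n)) : R :=
  \sum_(G : bigraph m n | E G)
    \prod_(uv : 'I_m * 'I_n) bernoulli_pmf p (uv \in G).

Definition avg_left (R : realType) (m n : nat) (G : bigraph m n) : R :=
  let AG := max_stable_sets (bigraph_adj G) in
  \sum_(A in AG) #|A :&: left_class m n|%:R / #|AG|%:R.

Definition logb (R : realType) (b x : R) : R := ln x / ln b.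

(* Main.v *)
Require Import Defs.
From mathcomp Require Import all_boot all_order all_algebra.
From mathcomp Require Import reals exp.
From mathcomp Require Import sequences bernoulli_distribution ring lra zify.

(* A maximal stable set A is determined by X = A :&: L, and the sets X that
   occur are those closed under the Galois connection "common non-neighbours",
   so the average is the mean size of a closed set. Put q = 1 - p, m = #|L| and
   n = #|R|.
   - If n is at most a small exponential in m, then with high probability every
     Y in R with #|Y| <= l + 2, where q ^ (l + 1) <= 1 / 4, is closed and has
     about q ^ #|Y| m common non-neighbours. At least three quarters of the
     closed Y have size at least l + 1, and these have at most (1 / 4 + delta) m
     common non-neighbours.
   - Otherwise let s be minimal with n q ^ s <= 1. All X slightly smaller than s
     are closed. If these include all X with #|X| <= m / 2, at least half of all
     subsets of L are closed, and almost no subset has more than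
     (1 / 2 + delta) m elements. If not, s is linear in m and at most about
     m / 2. A closed X with #|X| >= s + g has at least 2 ^ g subsets Z of size
     s, while the expected number of stable pairs (Z, Y) with #|Z| = s is
     'C(m, s) (1 + q ^ s) ^ n <= e 'C(m, s). So the large closed sets are
     exponentially fewer than the closed sets of size slightly below s. *)

Import Order.TTheory GRing.Theory Num.Theory.

Local Open Scope ring_scope.

Set Implicit Arguments.
Unset Strict Implicit.
Unset Printing Implicit Defensive.

(** * Closed sets of a bipartite graph *)

Section BipartiteGraphs.
Variables (I J : finType).
Implicit Types (G : {set I * J}) (X Z : {set I}) (Y : {set J}).

Definition nbr G u : {set J} := [set v | (u, v) \in G].

Definition tr G : {set J * I} := [set vu | (vu.2, vu.1) \in G].

Definition cononbr G Y : {set I} := [set u | [disjoint nbr G u & Y]].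

End BipartiteGraphs.

(** Fixed points of the closure operator of the Galois connection. As [tr] swaps the two sides,
    [closed_sets (tr G)] is the corresponding family on the right. *)
Definition closed_sets (I J : finType) (G : {set I * J}) : {set {set I}} :=
  [set X | cononbr G (cononbr (tr G) X) == X].

Lemma trK (I J : finType) : cancel (@tr I J) (@tr J I).
Proof. by move=> G; apply/setP=> -[u v]; rewrite !inE. Qed.

Section Cononbr.
Variables (I J : finType) (G : {set I * J}).
Implicit Types (X Z : {set I}) (Y : {set J}).

Lemma in_cononbr Y u : (u \in cononbr G Y) = [forall v in Y, (u, v) \notin G].
Proof.
rewrite inE disjoint_sym disjoint_subset; apply/subsetP/forall_inP => h v /h.
  by rewrite !inE.
by rewrite !inE.
Qed.

Lemma cononbrP Y u :
  reflect (forall v, v \in Y -> (u, v) \notin G) (u \in cononbr G Y).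
Proof. by rewrite in_cononbr; apply: forall_inP. Qed.

Lemma cononbrS Y Y' : Y \subset Y' -> cononbr G Y' \subset cononbr G Y.
Proof.
move=> /subsetP YY'; apply/subsetP=> u /cononbrP h; apply/cononbrP=> v /YY'.
exact: h.
Qed.

End Cononbr.

Section GaloisConnection.
Variables (I J : finType) (G : {set I * J}).
Implicit Types (X Z : {set I}) (Y : {set J}).

Lemma in_cononbr_tr X v :
  reflect (forall u, u \in X -> (u, v) \notin G) (v \in cononbr (tr G) X).
Proof.
rewrite in_cononbr; apply: (iffP forall_inP) => h u /h; by rewrite inE.
Qed.

(** Both inclusions say that no edge joins [X] to [Y]. *)
Lemma sub_cononbr X Y :
  (X \subset cononbr G Y) = (Y \subset cononbr (tr G) X).
Proof.
apply/subsetP/subsetP => [h v vY|h u uX].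
  by apply/in_cononbr_tr=> u /h/cononbrP; apply.
by apply/cononbrP=> v /h/in_cononbr_tr; apply.
Qed.

Lemma sub_closure X : X \subset cononbr G (cononbr (tr G) X).
Proof. by rewrite sub_cononbr. Qed.

Lemma cononbr_trK Y :
  cononbr G (cononbr (tr G) (cononbr G Y)) = cononbr G Y.
Proof.
apply/eqP; rewrite eqEsubset sub_closure andbT cononbrS //.
by rewrite -sub_cononbr.
Qed.

End GaloisConnection.

(** * Maximal stable sets as closed sets *)

Section MaxStable.
Variables (m n : nat) (G : bigraph m n).
Let AG := max_stable_sets (bigraph_adj G).
Let lpart (A : {set 'I_m + 'I_n}) : {set 'I_m} := [set u | inl u \in A].
Let rpart (A : {set 'I_m + 'I_n}) : {set 'I_n} := [set v | inr v \in A].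
Let glue (X : {set 'I_m}) (Y : {set 'I_n}) : {set 'I_m + 'I_n} :=
  [set x | match x with inl u => u \in X | inr v => v \in Y end].

(** In each equation the inclusion from left to right is stability and the reverse one is
    maximality. *)
Lemma mem_max_stable_sets A :
  (A \in AG) = (lpart A == cononbr G (rpart A)) &&
               (rpart A == cononbr (tr G) (lpart A)).
Proof.
rewrite inE /max_stable_set /stable_set; apply/andP/andP.
  move=> [/forall_inP st /forall_inP mx]; split; apply/eqP/setP.
    move=> u; rewrite inE; apply/idP/cononbrP => [uA v|h].
      by rewrite inE => vA; have /forall_inP/(_ _ vA) := st _ uA.
    apply/negPn/negP=> uA; have := mx (inl u); rewrite inE uA => /(_ isT).
    by case/exists_inP=> -[w|v] // vA /=; apply/negP/h; rewrite inE.
  move=> v; rewrite inE; apply/idP/in_cononbr_tr => [vA u|h].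
    by rewrite inE => uA; have /forall_inP/(_ _ vA) := st _ uA.
  apply/negPn/negP=> vA; have := mx (inr v); rewrite inE vA => /(_ isT).
  by case/exists_inP=> -[u|w] // uA /=; apply/negP/h; rewrite inE.
move=> [/eqP/setP lA /eqP/setP rA]; split; apply/forall_inP.
  move=> [u|v] xA; apply/forall_inP=> -[u'|v'] yA //=.
    have /cononbrP : u \in cononbr G (rpart A) by rewrite -lA inE.
    by apply; rewrite inE.
  have /cononbrP : u' \in cononbr G (rpart A) by rewrite -lA inE.
  by apply; rewrite inE.
move=> [u|v]; rewrite inE => xA.
  have : u \notin cononbr G (rpart A) by rewrite -lA inE.
  rewrite in_cononbr negb_forall => /existsP[v]; rewrite negb_imply negbK => /andP[vA e].
  by apply/exists_inP; exists (inr v) => //; rewrite inE in vA.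
have : v \notin cononbr (tr G) (lpart A) by rewrite -rA inE.
rewrite in_cononbr negb_forall => /existsP[u]; rewrite negb_imply negbK => /andP[uA e].
by apply/exists_inP; exists (inl u); [move: uA | move: e]; rewrite inE.
Qed.

Lemma card_left_class A : #|A :&: left_class m n| = #|lpart A|.
Proof.
rewrite -(@card_imset _ _ (@inl 'I_m 'I_n)); last by move=> ? ? [].
congr #|pred_of_set _|; apply/setP=> x; rewrite !inE; apply/andP/imsetP.
  by move=> [xA /imsetP[u _ xE]]; exists u => //; rewrite inE -xE.
by move=> [u]; rewrite inE => uA ->; split=> //; apply: imset_f.
Qed.

Lemma lpart_inj : {in AG &, injective lpart}.
Proof.
move=> A B; rewrite !mem_max_stable_sets => /andP[_ /eqP rA] /andP[_ /eqP rB] e.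
have e' : rpart A = rpart B by rewrite rA rB e.
apply/setP=> -[u|v]; first by move/setP/(_ u): e; rewrite !inE.
by move/setP/(_ v): e'; rewrite !inE.
Qed.

Lemma rpart_inj : {in AG &, injective rpart}.
Proof.
move=> A B; rewrite !mem_max_stable_sets => /andP[/eqP lA _] /andP[/eqP lB _] e.
have e' : lpart A = lpart B by rewrite lA lB e.
apply/setP=> -[u|v]; first by move/setP/(_ u): e'; rewrite !inE.
by move/setP/(_ v): e; rewrite !inE.
Qed.

(** A closed [X] glued to its common non-neighbourhood is a maximal stable set with left part
    [X]. *)
Lemma closed_sets_lpart : closed_sets G = lpart @: AG.
Proof.
apply/setP=> X; rewrite inE; apply/eqP/imsetP => [XE|[A + ->]]; last first.
  by rewrite mem_max_stable_sets => /andP[/eqP lA /eqP <-]; rewrite -lA.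
have lE : lpart (glue X (cononbr (tr G) X)) = X.
  by apply/setP=> u; rewrite !inE.
have rE : rpart (glue X (cononbr (tr G) X)) = cononbr (tr G) X.
  by apply/setP=> v; rewrite !inE.
by exists (glue X (cononbr (tr G) X)); rewrite // mem_max_stable_sets lE rE XE !eqxx.
Qed.

Lemma closed_sets_rpart : closed_sets (tr G) = rpart @: AG.
Proof.
apply/setP=> Y; rewrite inE trK; apply/eqP/imsetP => [YE|[A + ->]]; last first.
  by rewrite mem_max_stable_sets => /andP[/eqP <- /eqP <-].
have lE : lpart (glue (cononbr G Y) Y) = cononbr G Y.
  by apply/setP=> u; rewrite !inE.
have rE : rpart (glue (cononbr G Y) Y) = Y.
  by apply/setP=> v; rewrite !inE.
by exists (glue (cononbr G Y) Y); rewrite // mem_max_stable_sets lE rE YE !eqxx.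
Qed.

Lemma avg_left_closed (R : realType) : avg_left R G =
  (\sum_(X in closed_sets G) #|X|%:R) / #|closed_sets G|%:R.
Proof.
rewrite /avg_left -mulr_suml closed_sets_lpart card_in_imset; last exact: lpart_inj.
rewrite big_imset /=; last exact: lpart_inj.
by under eq_bigr do rewrite card_left_class.
Qed.

(** The same average indexed by right parts, the form suited to [n] small compared with an
    exponential in [m]. *)
Lemma avg_left_closed_tr (R : realType) : avg_left R G =
  (\sum_(Y in closed_sets (tr G)) #|cononbr G Y|%:R) / #|closed_sets (tr G)|%:R.
Proof.
rewrite /avg_left -mulr_suml closed_sets_rpart card_in_imset; last exact: rpart_inj.
rewrite big_imset /=; last exact: rpart_inj.
congr (_ / _); apply: eq_bigr => A; rewrite mem_max_stable_sets => /andP[/eqP e _].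
by rewrite card_left_class e.
Qed.

End MaxStable.

(** * Expectations over random sets *)

Section RandomSets.
Variables (R : realType) (p : R).

(** Expectation over a random subset. It serves both for graphs, as subsets of [I * J], and for
    single neighbourhoods, as subsets of [J]. *)
Definition Ex (T : finType) (F : {set T} -> R) : R :=
  \sum_(S : {set T}) F S * \prod_(x : T) bernoulli_pmf p (x \in S).

Lemma Ex_prod (T : finType) (f : T -> bool -> R) :
  Ex (fun S : {set T} => \prod_x f x (x \in S)) =
  \prod_x (p * f x true + (1 - p) * f x false).
Proof.
rewrite bigA_distr /Ex; apply: eq_bigr => S _.
rewrite -big_split; apply: eq_bigr => x _ /=; rewrite /bernoulli_pmf.
by case: (x \in S); rewrite mulrC.
Qed.

(** Neighbourhoods of distinct left vertices are independent: [h] and [h'] identify a graph with the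
    family of its rows, and the weight factors accordingly. *)
Lemma Ex_rows (I J : finType) (f : I -> {set J} -> R) :
  Ex (fun G : {set I * J} => \prod_u f u (nbr G u)) = \prod_u Ex (f u).
Proof.
pose w (S : {set J}) : R := \prod_x bernoulli_pmf p (x \in S).
rewrite /Ex (bigA_distr_bigA (fun u S => f u S * w S)) /=.
pose h (g : {ffun I -> {set J}}) : {set I * J} := [set uv | uv.2 \in g uv.1].
pose h' (G : {set I * J}) : {ffun I -> {set J}} := [ffun u => nbr G u].
have hK : cancel h h'.
  by move=> g; apply/ffunP=> u; rewrite ffunE; apply/setP=> v; rewrite !inE.
have h'K : cancel h' h.
  by move=> G; apply/setP=> -[u v]; rewrite inE ffunE inE.
rewrite (reindex h) /=; last by exists h' => x _; [exact: hK | exact: h'K].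
apply: eq_bigr => g _; rewrite big_split /=; congr (_ * _).
  by apply: eq_bigr => u _; rewrite -{2}(hK g) ffunE.
rewrite pair_bigA /=; apply: eq_bigr => -[u v] _ /=.
by rewrite inE.
Qed.

Lemma Ex_tr (I J : finType) (F : {set J * I} -> R) :
  Ex (fun G : {set I * J} => F (tr G)) = Ex F.
Proof.
rewrite [RHS](reindex (@tr I J)) /=; last first.
  by exists (@tr J I) => x _; apply: trK.
apply: eq_bigr => G _; congr (_ * _).
pose sw (x : J * I) := (x.2, x.1).
rewrite (reindex sw) /=; last by exists (fun x => (x.2, x.1)) => -[].
by apply: eq_bigr => -[v u] _; rewrite inE.
Qed.

Lemma eq_Ex (T : finType) (F F' : {set T} -> R) : F =1 F' -> Ex F = Ex F'.
Proof. by move=> e; apply: eq_bigr => S _; rewrite e. Qed.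

Lemma ExD (T : finType) (F F' : {set T} -> R) :
  Ex (fun S => F S + F' S) = Ex F + Ex F'.
Proof. by rewrite -big_split; apply: eq_bigr => S _; rewrite mulrDl. Qed.

Lemma Ex_sum (T K : finType) (P : pred K) (F : K -> {set T} -> R) :
  Ex (fun S => \sum_(k | P k) F k S) = \sum_(k | P k) Ex (F k).
Proof.
by rewrite exchange_big; apply: eq_bigr => S _; rewrite mulr_suml.
Qed.

Lemma ExZ (T : finType) c (F : {set T} -> R) : Ex (fun S => c * F S) = c * Ex F.
Proof. by rewrite mulr_sumr; apply: eq_bigr => S _; rewrite mulrA. Qed.

Lemma Ex_const (T : finType) c : Ex (fun _ : {set T} => c) = c.
Proof.
rewrite (eq_Ex (F' := fun S : {set T} => c * \prod_(x : T) 1)) => [|S]; last first.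
  by rewrite big1_eq mulr1.
rewrite ExZ (Ex_prod (fun _ _ => 1)) big1 ?mulr1 // => x _; lra.
Qed.

Hypotheses (p0 : 0 <= p) (p1 : p <= 1).

Lemma Ex_le (T : finType) (F F' : {set T} -> R) :
  (forall S, F S <= F' S) -> Ex F <= Ex F'.
Proof.
move=> h; apply: ler_sum => S _; apply: ler_wpM2r => //.
by apply: prodr_ge0 => x _; apply: bernoulli_pmf_ge0; rewrite p0 p1.
Qed.

Lemma Ex_disjoint (T : finType) (Y : {set T}) :
  Ex (fun S => [disjoint S & Y]%:R) = (1 - p) ^+ #|Y|.
Proof.
pose f x b : R := (~~ ((x \in Y) && b))%:R.
rewrite (eq_Ex (F' := fun S => \prod_x f x (x \in S))).
  rewrite Ex_prod -prodr_const [RHS]big_mkcond; apply: eq_bigr => x _.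
  by rewrite /f; case: (x \in Y) => /=; lra.
move=> S; apply/esym; case: (boolP [disjoint _ & _]) => [d|].
  apply: big1 => x _; rewrite /f; case: (boolP (_ && _)) => // /andP[xY xS].
  by rewrite (disjointFr d xS) in xY.
rewrite -setI_eq0 => /set0Pn[x]; rewrite inE => /andP[xS xY].
by rewrite (bigD1 x) //= /f xS xY mul0r.
Qed.

(** The event is that [S] misses [Y] but not [v |: Y], so its probability is a difference of two
    values of [Ex_disjoint]. *)
Lemma Ex_disjoint_mem (T : finType) (Y : {set T}) v : v \notin Y ->
  Ex (fun S => ([disjoint S & Y] && (v \in S))%:R) = p * (1 - p) ^+ #|Y|.
Proof.
move=> vY.
rewrite -(Ex_disjoint Y) -[LHS](addrK (Ex (fun S => [disjoint S & v |: Y]%:R))).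
rewrite -ExD (eq_Ex (F' := fun S => [disjoint S & Y]%:R)); last first.
  move=> S; rewrite -!setI_eq0 setIUr setU_eq0 [S :&: [set v]]setIC !setI_eq0 disjoints1.
  by case: (v \in S); case: [disjoint _ & _]; rewrite /= ?addr0 ?add0r.
rewrite !Ex_disjoint cardsU1 vY exprS; lra.
Qed.

End RandomSets.

Section Events.
Variables (R : realType) (p : R).
Hypotheses (p0 : 0 < p) (p1 : p < 1).
Local Notation q := (1 - p).

Lemma Ex_not (T : finType) (b : pred {set T}) :
  Ex p (fun S => (~~ b S)%:R) = 1 - Ex p (fun S => (b S)%:R).
Proof.
apply/eqP; rewrite eq_sym subr_eq -ExD -[eqbLHS](Ex_const p T).
by apply/eqP/eq_Ex => S; case: (b S); rewrite /= ?add0r ?addr0.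
Qed.

(** Markov's inequality: [F] dominates the indicator of failure, so its expectation bounds the
    failure probability. *)
Lemma bigraph_Pr_ge (m n : nat) (E : pred (bigraph m n))
    (F : bigraph m n -> R) :
  (forall G, 0 <= F G) -> (forall G, ~~ E G -> 1 <= F G) ->
  1 - Ex p F <= bigraph_Pr p E.
Proof.
move=> F0 F1; have -> : bigraph_Pr p E = Ex p (fun G => (E G)%:R).
  rewrite /bigraph_Pr big_mkcond; apply: eq_bigr => G _.
  by case: (E G); rewrite ?mul1r ?mul0r.
rewrite lerBlDr -lerBlDl -Ex_not; apply: (Ex_le (ltW p0) (ltW p1)) => G.
by case: (boolP (E G)) => [_|/F1].
Qed.

(** The number of common non-neighbours of [Y] is binomial with [#|I|] trials and success
    probability [q ^+ #|Y|]; this is its generating function. The value [c = expR (d / 4)] serves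
    tail bounds, and [c = 2] counts stable pairs. *)
Lemma Ex_cononbr_expn (I J : finType) (Y : {set J}) (c : R) :
  Ex p (fun G : {set I * J} => c ^+ #|cononbr G Y|) =
  (1 + (c - 1) * q ^+ #|Y|) ^+ #|I|.
Proof.
pose f (u : I) (S : {set J}) := 1 + (c - 1) * [disjoint S & Y]%:R.
rewrite (eq_Ex p (F' := fun G : {set I * J} => \prod_u f u (nbr G u))).
  rewrite Ex_rows -[RHS]prodr_const; apply: eq_big => // u _.
  by rewrite /f ExD ExZ Ex_const Ex_disjoint.
move=> G; rewrite -prodr_const big_mkcond; apply: eq_bigr => u _.
by rewrite /f inE; case: [disjoint _ & _]; rewrite /= ?mulr1 ?mulr0; lra.
Qed.

(** If [Y] is not closed, its closure contains some [v] outside [Y]: no left vertex misses [Y] and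
    is adjacent to [v]. Each left vertex does so independently with probability [p * q ^+ #|Y|]; sum
    over [v]. *)
Lemma Ex_unclosed_tr (I J : finType) (Y : {set J}) :
  Ex p (fun G : {set I * J} => (Y \notin closed_sets (tr G))%:R) <=
  #|J|%:R * (1 - p * q ^+ #|Y|) ^+ #|I|.
Proof.
pose f v (S : {set J}) : R := (~~ ([disjoint S & Y] && (v \in S)))%:R.
apply: (@le_trans _ _ (\sum_(v | v \notin Y) (1 - p * q ^+ #|Y|) ^+ #|I|)).
  rewrite (eq_bigr (fun v => Ex p (fun G : {set I * J} => \prod_u f v (nbr G u)))).
    rewrite -Ex_sum; apply: (Ex_le (ltW p0) (ltW p1)) => G.
    have f01 v : 0 <= \prod_u f v (nbr G u).
      by apply: prodr_ge0 => u _; apply: ler0n.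
    case: (boolP (_ \in _)) => [_|]; first exact: sumr_ge0.
    rewrite inE trK eqEsubset negb_and orbC.
    have := sub_closure (tr G) Y; rewrite trK => -> /= /subsetPn[v vc vY].
    rewrite (bigD1 v) //= big1 ?lerDl ?sumr_ge0 // => u _.
    rewrite /f; case: (boolP (_ && _)) => // /andP[d].
    have uc : u \in cononbr G Y by rewrite inE.
    by rewrite inE => uv; move/in_cononbr_tr/(_ _ uc): vc; rewrite uv.
  move=> v vY; rewrite (Ex_rows p (fun _ => f v)) prodr_const Ex_not.
  by rewrite Ex_disjoint_mem.
rewrite sumr_const -[leLHS]mulr_natl ler_wpM2r ?ler_nat ?max_card //.
have [q0 q1] : 0 <= q /\ q <= 1 by rewrite subr_ge0 gerBl !ltW.
by rewrite exprn_ge0 // subr_ge0 mulr_ile1 ?exprn_ile1 ?exprn_ge0 // ltW.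
Qed.

Lemma Ex_unclosed (I J : finType) (X : {set I}) :
  Ex p (fun G : {set I * J} => (X \notin closed_sets G)%:R) <=
  #|I|%:R * (1 - p * q ^+ #|X|) ^+ #|J|.
Proof.
rewrite (eq_Ex p (F' := fun G => (X \notin closed_sets (tr (tr G)))%:R)).
  rewrite (Ex_tr p (fun G => (X \notin closed_sets (tr G))%:R)).
  exact: Ex_unclosed_tr.
by move=> G; rewrite trK.
Qed.

End Events.

(** * Counting closed sets *)

Section Counting.
Local Open Scope nat_scope.
Variable T : finType.

Lemma card_small_setS l :
  #|[set A : {set T} | #|A| <= l.+1]| =
  #|[set A : {set T} | #|A| <= l]| + 'C(#|T|, l.+1).
Proof.
rewrite -card_draws -cardsUI [X in _ + #|pred_of_set X|](_ : _ = set0) ?cards0 ?addn0.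
  by apply: eq_card => A; rewrite !inE leq_eqVlt orbC ltnS.
by apply/setP=> A; rewrite !inE; apply/negP=> /andP[a /eqP b]; move: a; rewrite b ltnn.
Qed.

Lemma card_small_set0 : #|[set A : {set T} | #|A| <= 0]| = 1.
Proof.
rewrite -(cards1 (set0 : {set T})); apply: eq_card => A.
by rewrite !inE leqn0 cards_eq0.
Qed.

Lemma card_small_set_le l : #|[set A : {set T} | #|A| <= l]| <= #|T|.+1 ^ l.
Proof.
have st k : 'C(#|T|, k.+1) <= #|T| * 'C(#|T|, k).
  apply: (@leq_trans (k.+1 * 'C(#|T|, k.+1))); first by rewrite leq_pmull.
  by rewrite mul_bin_left leq_mul2r leq_subr orbT.
have bl k : 'C(#|T|, k) <= #|[set A : {set T} | #|A| <= k]|.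
  rewrite -card_draws; apply: subset_leq_card; apply/subsetP => A.
  by rewrite !inE => /eqP->.
elim: l => [|l IH]; first by rewrite card_small_set0.
rewrite card_small_setS expnS mulSn leq_add //.
apply: leq_trans (st l) _; rewrite leq_mul2l; apply/orP; right.
exact: leq_trans (bl l) IH.
Qed.

(** In this range each binomial coefficient is at least twice the preceding one, so it dominates the
    sum of all earlier ones. *)
Lemma card_small_set_bin l : 3 * l + 2 <= #|T| ->
  #|[set A : {set T} | #|A| <= l]| <= 'C(#|T|, l.+1).
Proof.
elim: l => [|l IH] h; first by rewrite card_small_set0 bin1; apply: leq_trans h.
rewrite card_small_setS.
have {}IH :=
  IH (leq_trans (leq_add (leq_mul (leqnn 3) (leqnSn l)) (leqnn 2)) h).
have := mul_bin_left #|T| l.+1.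
set a := 'C(_, l.+1) in IH *; set b := 'C(_, l.+2) => e.
have le : (l.+2 * (2 * a) <= l.+2 * b)%N.
  rewrite e mulnA leq_mul2r; apply/orP; right; move: #|T| h => n h; lia.
by rewrite leq_pmul2l // in le; lia.
Qed.

Lemma card_small_set_double l : 3 * l + 2 <= #|T| ->
  2 * #|[set A : {set T} | #|A| <= l]| <= #|[set A : {set T} | #|A| <= l.+1]|.
Proof. by move=> /card_small_set_bin; rewrite card_small_setS; lia. Qed.

(** Complementation sends every set with more than half of the elements to one counted on the
    right. *)
Lemma card_half_set_ge :
  2 ^ #|T| <= 2 * #|[set A : {set T} | #|A| <= #|T|./2]|.
Proof.
rewrite -{1}cardsT -card_powerset mul2n -addnn.
rewrite -{2}(card_imset [set A : {set T} | _] (can_inj (@setCK T))).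
apply: leq_trans (leq_card_setU _ _); apply: subset_leq_card.
apply/subsetP=> A _; rewrite !inE; case: leqP => //= h.
apply/imsetP; exists (~: A); rewrite ?setCK // inE.
move: (cardsC A) (odd_double_half #|T|) h; move: #|A| #|~: A| #|T| => a b n.
by move: n./2 (odd n) => k []; lia.
Qed.

(** Induction by Pascal's rule: for [a.+1] and [b.+1], both summands are at least ['C(a + b, a)]. *)
Lemma bin_ge_expn2 g a b : g <= a -> g <= b -> 2 ^ g <= 'C(a + b, a).
Proof.
elim: g a b => [|g IH] a b ga gb; first by rewrite bin_gt0 leq_addr.
case: a ga => // a ga; case: b gb => // b gb.
rewrite expnS mul2n -addnn addSn binS; have := IH _ _ ga gb => h.
by rewrite leq_add ?(leq_trans h) // addnS ?binS ?leq_addl // leq_bin2l.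
Qed.

End Counting.

Section ClosedSets.
Variables (I J : finType) (G : {set I * J}).

Lemma card_closed_sets_gt0 : (0 < #|closed_sets G|)%N.
Proof.
apply/card_gt0P; exists (cononbr G set0).
by rewrite inE cononbr_trK.
Qed.

(* A closed set X is determined by its common non-neighbourhood, which lies in
   that of each of the at least 2 ^ g subsets Z of X of size s. *)
Lemma card_large_closed_le (s g : nat) : (g <= s)%N ->
  (2 ^ g * #|[set X in closed_sets G | s + g <= #|X|]| <=
   \sum_(Z : {set I} | #|Z| == s) 2 ^ #|cononbr (tr G) Z|)%N.
Proof.
move=> gs; pose L := [set X in closed_sets G | (s + g <= #|X|)%N].
(* Double counting of the pairs of a large closed [X] and a subset [Z] of it of size [s]. *)
apply: (@leq_trans (\sum_(X in L) \sum_(Z : {set I} | #|Z| == s) (Z \subset X))%N).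
  rewrite mulnC -sum_nat_const; apply: leq_sum => X; rewrite inE => /andP[_ sX].
  rewrite -big_mkcondr sum1_card.
  apply: (@leq_trans 'C(#|X|, s)).
    rewrite -(subnKC (leq_trans (leq_addr g s) sX)).
    by apply: bin_ge_expn2 => //; rewrite leq_subRL // (leq_trans (leq_addr g s)).
  rewrite -cards_draws; apply: subset_leq_card; apply/subsetP => Z.
  by rewrite inE unfold_in andbC.
rewrite exchange_big; apply: leq_sum => Z _ /=.
rewrite -big_mkcondr sum1_card -card_powerset.
rewrite -(card_in_imset (f := fun X : {set I} => cononbr (tr G) X)).
  apply: subset_leq_card; apply/subsetP => Y /imsetP[X].
  by rewrite unfold_in => /andP[_ ZX] ->; rewrite inE cononbrS.
move=> X X'; rewrite [_ \in _]unfold_in => /andP[XL _].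
rewrite [_ \in _]unfold_in => /andP[XL' _] e.
move: XL XL'; rewrite !inE => /andP[/eqP XE _] /andP[/eqP XE' _].
by rewrite -XE e XE'.
Qed.

End ClosedSets.

Section Averages.
Variables (R : realType) (m n : nat) (G : bigraph m n).

(** Each term is at most [c * b], plus [b] if it is bad, and at most a fraction [d] of the terms is
    bad. *)
Lemma avg_le_of_bad (T : finType) (A : {set {set T}}) (F : {set T} -> R)
    (P : pred {set T}) (b c d : R) :
  (0 < #|A|)%N -> 0 <= b -> (forall X, F X <= b) -> 0 <= c ->
  (forall X, X \in A -> ~~ P X -> F X <= c * b) ->
  #|[set X in A | P X]|%:R <= d * #|A|%:R ->
  (\sum_(X in A) F X) / #|A|%:R <= (c + d) * b.
Proof.
move=> A0 b0 Fb c0 Fc bad; rewrite ler_pdivrMr ?ltr0n //.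
apply: (@le_trans _ _ (\sum_(X in A) (c * b + (P X)%:R * b))).
  apply: ler_sum => X XA; case: (boolP (P X)) => [_|nP]; last first.
    by rewrite mul0r addr0 Fc.
  by rewrite mul1r (le_trans (Fb X)) // lerDr mulr_ge0.
rewrite big_split /= sumr_const -mulr_suml -natr_sum.
have -> : (\sum_(X in A) P X)%N = #|[set X in A | P X]|.
  rewrite -sum1_card [RHS](eq_bigl (fun X => (X \in A) && P X)) ?big_mkcondr //.
  by move=> X; rewrite inE.
rewrite -[X in X + _]mulr_natr -[leRHS]mulrA [b * _]mulrC mulrDl.
by rewrite -mulrA [b * _]mulrC lerD2l mulrA ler_wpM2r.
Qed.

Lemma avg_left_le_large (c d : R) : 0 <= c ->
  #|[set X in closed_sets G | c * m%:R < #|X|%:R]|%:R <=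
    d * #|closed_sets G|%:R ->
  avg_left R G <= (c + d) * m%:R.
Proof.
move=> c0 bad; rewrite avg_left_closed.
apply: (avg_le_of_bad (P := fun X => c * m%:R < #|X|%:R)) => //.
- exact: card_closed_sets_gt0.
- by move=> X; rewrite ler_nat -[leqRHS]card_ord max_card.
- by move=> X _; rewrite -leNgt.
Qed.

(** The bad sets are those with [#|Y| <= l]. Two doublings, up to size [l.+2], show that they are at
    most a quarter of the closed sets. *)
Lemma avg_left_le_small (l : nat) (d : R) :
  (3 * l.+1 + 2 <= n)%N -> 0 <= d ->
  (forall Y : {set 'I_n}, (#|Y| <= l.+2)%N -> Y \in closed_sets (tr G)) ->
  (forall Y : {set 'I_n}, #|Y| == l.+1 -> #|cononbr G Y|%:R <= (1 / 4 + d) * m%:R) ->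
  avg_left R G <= (1 / 2 + d) * m%:R.
Proof.
move=> ln d0 cl sz; rewrite avg_left_closed_tr.
have -> : 1 / 2 + d = (1 / 4 + d) + 1 / 4 :> R by lra.
apply: (avg_le_of_bad (P := fun Y => #|Y| <= l)%N) => //.
- exact: card_closed_sets_gt0.
- by move=> X; rewrite ler_nat -[leqRHS]card_ord max_card.
- lra.
- move=> Y _; rewrite -ltnNge => lY.
  (* A larger [Y] contains some [Z] of size [l.+1], which has at least as many common
     non-neighbours. *)
  have : (0 < 'C(#|Y|, l.+1))%N by rewrite bin_gt0.
  rewrite -cards_draws => /card_gt0P[Z]; rewrite inE => /andP[ZY Zl].
  by rewrite (le_trans _ (sz Z Zl)) // ler_nat subset_leq_card // cononbrS.
have h1 := @card_small_set_double 'I_n l; rewrite card_ord in h1.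
have h2 := @card_small_set_double 'I_n l.+1; rewrite card_ord in h2.
have {h1} := h1 (leq_trans (leq_add (leq_mul (leqnn 3) (leqnSn l)) (leqnn 2)) ln).
have {h2} := h2 ln.
have : (#|[set Y : {set 'I_n} | (#|Y| <= l.+2)%N]| <= #|closed_sets (tr G)|)%N.
  by apply: subset_leq_card; apply/subsetP => Y; rewrite inE => /cl.
have : (#|[set Y in closed_sets (tr G) | (#|Y| <= l)%N]| <=
        #|[set Y : {set 'I_n} | (#|Y| <= l)%N]|)%N.
  by apply: subset_leq_card; apply/subsetP => Y; rewrite !inE => /andP[].
move: #|_| #|_| #|_| #|_| #|_| => a b c e f fe cb ac ea.
have : (4 * f <= b)%N by lia.
rewrite -(ler_nat R) natrM; lra.
Qed.

Lemma avg_left_all_closed : (forall X : {set 'I_m}, X \in closed_sets G) ->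
  avg_left R G <= (1 / 2) * m%:R.
Proof.
move=> cl; rewrite avg_left_closed ler_pdivrMr ?ltr0n ?card_closed_sets_gt0 //.
have -> : closed_sets G = [set: {set 'I_m}] by apply/setP=> X; rewrite cl inE.
rewrite (eq_bigl xpredT) => [|X]; last by rewrite inE.
set S := (X in X <= _).
(* Pair each set with its complement. *)
have SS : S + S = m%:R * #|[set: {set 'I_m}]|%:R.
  rewrite {1}/S (reindex_inj (can_inj (@setCK _))) /= -big_split /=.
  rewrite (eq_bigr (fun=> m%:R)) => [|X _]; last first.
    by rewrite -natrD addnC cardsC card_ord.
  by rewrite sumr_const cardsT -[LHS]mulr_natr.
rewrite -[leRHS]mulrA -SS; clearbody S; lra.
Qed.

End Averages.

(** * Tail bounds *)

Section Chernoff.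
Variable R : realType.

(** From [expR x * (1 - x) <= 1] and [(1 - x) * (1 + x + 2 * x ^+ 2) = 1 + x ^+ 2 * (1 - 2 * x) >=
    1]. *)
Lemma expR_le_quadratic (x : R) : 0 <= x -> x <= 1 / 2 ->
  expR x <= 1 + x + 2 * x ^+ 2.
Proof.
move=> x0 x1; have h := expR_ge1Dx (- x).
have e : expR x * expR (- x) = 1 by rewrite -expRD subrr expR0.
have := expR_gt0 x; nra.
Qed.

Lemma mgf_le (d x : R) : 0 <= d -> d <= 1 -> 0 <= x -> x <= 1 ->
  1 + (expR (d / 4) - 1) * x <= expR (d / 4 * (x + d) - d ^+ 2 / 8).
Proof.
move=> d0 d1 x0 x1; apply: le_trans (expR_ge1Dx _).
have : expR (d / 4) <= 1 + d / 4 + 2 * (d / 4) ^+ 2.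
  by apply: expR_le_quadratic; lra.
nra.
Qed.

(** The left side is the exponential Markov bound, with parameter [d / 4], for a binomial variable
    of mean [x * m] to reach [(x + d) * m]. *)
Lemma chernoff_le (d x : R) (m : nat) : 0 <= d -> d <= 1 -> 0 <= x -> x <= 1 ->
  expR (- (d / 4 * (x + d) * m%:R)) * (1 + (expR (d / 4) - 1) * x) ^+ m <=
  expR (- (d ^+ 2 / 8 * m%:R)).
Proof.
move=> d0 d1 x0 x1.
have h : (1 + (expR (d / 4) - 1) * x) ^+ m <=
         expR (m%:R * (d / 4 * (x + d) - d ^+ 2 / 8)).
  rewrite expRM_natl lerXn2r ?nnegrE ?expR_ge0 ?mgf_le //.
  rewrite addr_ge0 // mulr_ge0 // subr_ge0 (le_trans _ (expR_ge1Dx _)) // lerDl; lra.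
apply: le_trans (ler_wpM2l (expR_ge0 _) h) _; rewrite -expRD ler_expR; lra.
Qed.

Lemma exp_tail_ge1 (l c : R) (m k : nat) : 0 <= l -> c * m%:R <= k%:R ->
  1 <= expR (- (l * c * m%:R)) * expR l ^+ k.
Proof.
move=> l0 ck; rewrite -expRM_natr -expRD -[leLHS]expR0 ler_expR -mulrA.
by rewrite addrC subr_ge0 ler_wpM2l.
Qed.

Lemma card_large_set_le (T : finType) (d : R) : 0 <= d -> d <= 1 ->
  #|[set X : {set T} | (1 / 2 + d) * #|T|%:R <= #|X|%:R]|%:R <=
  2 ^+ #|T| * expR (- (d ^+ 2 / 8 * #|T|%:R)).
Proof.
move=> d0 d1; pose c := expR (d / 4).
have sumE : \sum_(X : {set T}) c ^+ #|X| = (1 + c) ^+ #|T|.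
  transitivity (\prod_(x : T) (c + 1)); last first.
    by rewrite prodr_const addrC.
  rewrite bigA_distr; apply: eq_bigr => X _.
  by rewrite -prodr_const big_mkcond.
have E : (1 + c) ^+ #|T| = 2 ^+ #|T| * (1 + (c - 1) * (1 / 2)) ^+ #|T|.
  by rewrite -exprMn; congr (_ ^+ _); lra.
apply: le_trans (ler_wpM2l (exprn_ge0 _ (ler0n _ 2))
  (chernoff_le (x := 1 / 2) _ d0 d1 _ _)); [|lra|lra].
rewrite mulrCA -E -sumE mulr_sumr -sum1_card natr_sum big_mkcond.
apply: ler_sum => X _; rewrite inE; case: ifP => [h|_].
  by apply: exp_tail_ge1 => //; lra.
by rewrite mulr_ge0 ?exprn_ge0 ?expR_ge0.
Qed.

End Chernoff.

(** * The ranges of m and n *)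

Section Cases.
Variables (R : realType) (p : R) (m n : nat).
Hypotheses (p0 : 0 < p) (p1 : p < 1).
Local Notation q := (1 - p).

Let q0 : 0 < q. Proof. by rewrite subr_gt0. Qed.
Let q1 : q <= 1. Proof. by rewrite gerBl ltW. Qed.

Lemma unclosed_prob_le (t k l : nat) : (k <= t)%N ->
  (1 - p * q ^+ k) ^+ l <= expR (- (p * q ^+ t * l%:R)).
Proof.
move=> kt; have pq : p * q ^+ t <= p * q ^+ k.
  by rewrite ler_wpM2l ?(ltW p0) // ler_wiXn2l // ltW.
have pq1 : p * q ^+ k <= 1.
  by rewrite mulr_ile1 ?exprn_ile1 ?exprn_ge0 // ltW.
rewrite -[in leRHS]mulNr expRM_natr lerXn2r ?nnegrE ?expR_ge0 ?subr_ge0 //.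
by apply: le_trans (expR_ge1Dx _); rewrite lerD2l lerN2.
Qed.

Lemma Ex_small_unclosed_le (t : nat) :
  Ex p (fun G : bigraph m n =>
    \sum_(X : {set 'I_m} | (#|X| <= t)%N) (X \notin closed_sets G)%:R) <=
  2 ^+ m * m%:R * expR (- (p * q ^+ t * n%:R)).
Proof.
rewrite Ex_sum.
apply: (@le_trans _ _ (\sum_(X : {set 'I_m}) m%:R * expR (- (p * q ^+ t * n%:R)))).
  rewrite big_mkcond; apply: ler_sum => X _; case: ifP => [Xt|_]; last first.
    by rewrite mulr_ge0 ?expR_ge0.
  apply: le_trans (Ex_unclosed p0 p1 'I_n X) _.
  by rewrite !card_ord ler_wpM2l // unclosed_prob_le.
rewrite sumr_const -[leLHS]mulr_natl -[leRHS]mulrA ler_wpM2r ?mulr_ge0 ?expR_ge0 //.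
by rewrite -cardsT -powersetT card_powerset cardsT card_ord natrX.
Qed.

Lemma sum_indicator_ge1 (T : finType) (P Q : pred T) (x : T) : P x -> Q x ->
  1 <= \sum_(y | P y) (Q y)%:R :> R.
Proof. by move=> Px Qx; rewrite (bigD1 x) //= Qx lerDl sumr_ge0. Qed.

(** [F1] counts the unclosed [Y] of size at most [l.+2], and [F2] is at least 1 as soon as some [Y]
    of size [l.+1] has too many common non-neighbours. Each has expectation at most
    [n.+1 ^+ l.+3 * expR (- (k * m))]. *)
Lemma avg_left_small_n (l : nat) (d k : R) :
  q ^+ l.+1 <= 1 / 4 -> 0 <= d -> d <= 1 -> (3 * l.+1 + 2 <= n)%N ->
  k <= d ^+ 2 / 8 -> k <= p * q ^+ l.+2 ->
  1 - 2 * n.+1%:R ^+ l.+3 * expR (- (k * m%:R)) <=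
    bigraph_Pr p (fun G : bigraph m n => avg_left R G <= (1 / 2 + d) * m%:R).
Proof.
move=> ql d0 d1 ln kd kq.
pose F1 (G : bigraph m n) : R :=
  \sum_(Y : {set 'I_n} | (#|Y| <= l.+2)%N) (Y \notin closed_sets (tr G))%:R.
pose F2 (G : bigraph m n) : R := \sum_(Y : {set 'I_n} | #|Y| == l.+1)
  expR (- (d / 4 * (1 / 4 + d) * m%:R)) * expR (d / 4) ^+ #|cononbr G Y|.
have F10 G : 0 <= F1 G by apply: sumr_ge0.
have F20 G : 0 <= F2 G.
  by apply: sumr_ge0 => Y _; rewrite mulr_ge0 ?exprn_ge0 ?expR_ge0.
apply: le_trans (bigraph_Pr_ge p0 p1 (F := fun G => F1 G + F2 G) _ _); first last.
- move=> G nE; rewrite leNgt; apply: contra nE => FG.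
  apply: (avg_left_le_small ln d0) => Y Yl.
    apply/negPn/negP => nY.
    have : 1 <= F1 G.
      exact: (sum_indicator_ge1 (P := fun Y : {set 'I_n} => (#|Y| <= l.+2)%N)
        (Q := fun Y => Y \notin closed_sets (tr G)) Yl nY).
    by move: (F20 G) FG => ? ? ?; lra.
  rewrite leNgt; apply/negP => /ltW big.
  have : 1 <= F2 G.
    rewrite /F2 (bigD1 Y) //= -[leLHS]addr0 lerD //.
      by apply: exp_tail_ge1 => //; lra.
    by apply: sumr_ge0 => Z _; rewrite mulr_ge0 ?exprn_ge0 ?expR_ge0.
  by move: (F10 G) FG => ? ? ?; lra.
- by move=> G; rewrite addr_ge0.
have N : #|[set Y : {set 'I_n} | (#|Y| <= l.+2)%N]|%:R <= n.+1%:R ^+ l.+2 :> R.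
  by rewrite -natrX ler_nat; have := card_small_set_le 'I_n l.+2; rewrite card_ord.
have kE c : k <= c -> expR (- (c * m%:R)) <= expR (- (k * m%:R)).
  by move=> kc; rewrite ler_expR lerN2 ler_wpM2r.
rewrite lerD2l lerN2 ExD mulrDl mul1r mulrDl lerD // Ex_sum.
- apply: (@le_trans _ _ (\sum_(Y : {set 'I_n} | (#|Y| <= l.+2)%N)
                          n%:R * expR (- (k * m%:R)))).
    apply: ler_sum => Y Yl; apply: le_trans (Ex_unclosed_tr p0 p1 'I_m Y) _.
    rewrite !card_ord ler_wpM2l //.
    by apply: le_trans (kE _ kq); apply: unclosed_prob_le.
  rewrite sumr_const -[leLHS]mulr_natl mulrA ler_wpM2r ?expR_ge0 //.
  rewrite exprSr ler_pM ?ler_nat //.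
  apply: le_trans N; rewrite ler_nat subset_leq_card //.
  by apply/subsetP => Y; rewrite inE.
- apply: (@le_trans _ _ (\sum_(Y : {set 'I_n} | #|Y| == l.+1) expR (- (k * m%:R)))).
    apply: ler_sum => Y /eqP Yl; rewrite ExZ Ex_cononbr_expn Yl card_ord.
    have c1 : 0 <= expR (d / 4) - 1.
      by rewrite subr_ge0 (le_trans _ (expR_ge1Dx _)) // lerDl; lra.
    apply: le_trans (kE _ kd).
    apply: le_trans (chernoff_le (x := 1 / 4) m d0 d1 _ _); [|lra|lra].
    rewrite ler_wpM2l ?expR_ge0 // lerXn2r ?nnegrE //.
    + by rewrite addr_ge0 // mulr_ge0 // exprn_ge0 // ltW.
    + by rewrite addr_ge0 // mulr_ge0 // divr_ge0.
    + by rewrite lerD2l ler_wpM2l.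
  rewrite sumr_const -[leLHS]mulr_natl ler_wpM2r ?expR_ge0 //.
  apply: (@le_trans _ _ (n.+1%:R ^+ l.+2)); last by rewrite ler_weXn2l // ler1n.
  apply: le_trans N; rewrite ler_nat subset_leq_card //; apply/subsetP => Y.
  by rewrite inE unfold_in => /eqP->.
Qed.

(** With the stated probability all subsets of the left class are closed; this handles bounded
    [m]. *)
Lemma avg_left_fixed_m :
  1 - 2 ^+ m * m%:R * expR (- (p * q ^+ m * n%:R)) <=
    bigraph_Pr p (fun G : bigraph m n => avg_left R G <= (1 / 2) * m%:R).
Proof.
apply: le_trans (bigraph_Pr_ge p0 p1 (F := fun G => \sum_(X : {set 'I_m}
  | (#|X| <= m)%N) (X \notin closed_sets G)%:R) _ _); last 2 first.
- by move=> G; apply: sumr_ge0.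
- move=> G nE; rewrite leNgt; apply: contra nE => FG.
  apply: avg_left_all_closed => X; apply/negPn/negP => nX.
  move: FG; rewrite ltNge; move/negP; apply.
  apply: (sum_indicator_ge1 (P := fun X : {set 'I_m} => (#|X| <= m)%N)
    (Q := fun X => X \notin closed_sets G)) nX.
  by rewrite -[leqRHS]card_ord max_card.
by rewrite lerD2l lerN2 Ex_small_unclosed_le.
Qed.

Lemma avg_left_huge_n (d : R) : 0 <= d -> d <= 1 ->
  2 * expR (- (d ^+ 2 / 8 * m%:R)) <= d ->
  1 - 2 ^+ m * m%:R * expR (- (p * q ^+ m./2 * n%:R)) <=
    bigraph_Pr p (fun G : bigraph m n => avg_left R G <= (1 / 2 + 2 * d) * m%:R).
Proof.
move=> d0 d1 md.
apply: le_trans (bigraph_Pr_ge p0 p1 (F := fun G => \sum_(X : {set 'I_m}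
  | (#|X| <= m./2)%N) (X \notin closed_sets G)%:R) _ _); last 2 first.
- by move=> G; apply: sumr_ge0.
- move=> G nE; rewrite leNgt; apply: contra nE => FG.
  have -> : 1 / 2 + 2 * d = (1 / 2 + d) + d by lra.
  apply: avg_left_le_large; first lra.
  have cl : (#|[set X : {set 'I_m} | (#|X| <= m./2)%N]| <= #|closed_sets G|)%N.
    apply: subset_leq_card; apply/subsetP => X; rewrite inE => Xm.
    apply/negPn/negP => nX; move: FG; rewrite ltNge; move/negP; apply.
    exact: (sum_indicator_ge1 (P := fun X : {set 'I_m} => (#|X| <= m./2)%N)
      (Q := fun X => X \notin closed_sets G) Xm nX).
  have := card_half_set_ge 'I_m; rewrite card_ord => half.
  (* The closed sets make up at least half of all subsets, so the Chernoff bound for all subsets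
     loses only a factor 2. *)
  have half' : 2 ^+ m <= 2 * #|closed_sets G|%:R :> R.
    by rewrite -natrX -natrM ler_nat (leq_trans half) // leq_mul2l.
  apply: (@le_trans _ _ (2 ^+ m * expR (- (d ^+ 2 / 8 * m%:R)))).
    have := card_large_set_le 'I_m d0 d1; rewrite card_ord => large.
    apply: le_trans large; rewrite ler_nat subset_leq_card //.
    by apply/subsetP => X; rewrite !inE => /andP[_ /ltW].
  apply: le_trans (ler_wpM2r (expR_ge0 _) half') _.
  by rewrite mulrC mulrA [_ * 2]mulrC ler_wpM2r.
by rewrite lerD2l lerN2 Ex_small_unclosed_le.
Qed.

(** A set of size [b + c] is the union of one of size [b] and one of size [c]. *)
Lemma leq_binD (a b c : nat) : ('C(a, b + c) <= 'C(a, b) * 'C(a, c))%N.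
Proof.
elim: a b => [|a IH] [|b]; rewrite ?add0n ?bin0 ?mul1n //.
apply: (@leq_trans ('C(a.+1, b.+1) * 'C(a, c))%N).
  by rewrite addSn !binS mulnDl leq_add // -addSn IH.
by rewrite leq_mul2l leq_bin2l ?orbT.
Qed.

(** Here [s = t + r]. Closedness of the sets of size [t] gives at least ['C(m, t)] closed sets,
    against which those of size at least [s + g] are few. *)
Lemma avg_left_large_n (d : R) (t r g : nat) : 0 < d ->
  (t + r <= m)%N -> (g <= t + r)%N ->
  (t + r + g)%:R <= (1 / 2 + d) * m%:R -> n%:R * q ^+ (t + r) <= 1 ->
  1 - (2 ^+ m * m%:R * expR (- (p * q ^+ t * n%:R)) +
       expR 1 / d * 'C(m, r)%:R / 2 ^+ g) <=
    bigraph_Pr p (fun G : bigraph m n => avg_left R G <= (1 / 2 + 2 * d) * m%:R).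
Proof.
move=> d0 sm gs sg nq; have b0 : 0 < 'C(m, t)%:R :> R.
  by rewrite ltr0n bin_gt0 (leq_trans (leq_addr r t)).
(* Normalised so that [F2 G < 1] leaves at most [d * 'C(m, t)] closed sets of size at least [s + g],
   by [card_large_closed_le]. *)
pose c : R := (2 ^+ g * (d * 'C(m, t)%:R))^-1.
have c0 : 0 < c by rewrite invr_gt0 !mulr_gt0 // exprn_gt0.
pose F1 (G : bigraph m n) : R :=
  \sum_(X : {set 'I_m} | (#|X| <= t)%N) (X \notin closed_sets G)%:R.
pose F2 (G : bigraph m n) : R :=
  c * \sum_(Z : {set 'I_m} | #|Z| == (t + r)%N) 2 ^+ #|cononbr (tr G) Z|.
have F10 G : 0 <= F1 G by apply: sumr_ge0.
have F20 G : 0 <= F2 G.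
  by rewrite mulr_ge0 ?(ltW c0) //; apply: sumr_ge0 => Z _; rewrite exprn_ge0.
apply: le_trans (bigraph_Pr_ge p0 p1 (F := fun G => F1 G + F2 G) _ _); first last.
- move=> G nE; rewrite leNgt; apply: contra nE => FG.
  have -> : 1 / 2 + 2 * d = (1 / 2 + d) + d by lra.
  apply: avg_left_le_large; first lra.
  have cl : ('C(m, t) <= #|closed_sets G|)%N.
    have := card_draws 'I_m t; rewrite card_ord => <-.
    apply: subset_leq_card; apply/subsetP => X; rewrite inE => /eqP Xt.
    apply/negPn/negP => nX.
    have : 1 <= F1 G.
      apply: (sum_indicator_ge1 (P := fun X : {set 'I_m} => (#|X| <= t)%N)
        (Q := fun X => X \notin closed_sets G) _ nX).
      by rewrite Xt.
    by move: (F20 G) FG => ? ? ?; lra.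
  apply: (@le_trans _ _ (d * 'C(m, t)%:R)); last by rewrite ler_pM2l // ler_nat.
  have F2lt : F2 G < 1 by move: (F10 G) FG => ? ?; lra.
  rewrite leNgt; apply/negP => bad; move: F2lt; rewrite ltNge; move/negP; apply.
  rewrite /F2 mulrC ler_pdivlMr ?mul1r; last by rewrite mulr_gt0 ?mulr_gt0 ?exprn_gt0.
  have := card_large_closed_le G gs; rewrite -(ler_nat R) natrM natr_sum natrX.
  under [X in _ <= X -> _]eq_bigr do rewrite natrX.
  apply: le_trans; rewrite ler_pM2l ?exprn_gt0 // (le_trans (ltW bad)) //.
  rewrite ler_nat subset_leq_card //; apply/subsetP => X; rewrite !inE.
  by move=> /andP[-> /ltW]; move/(le_trans sg); rewrite ler_nat.
- by move=> G; rewrite addr_ge0.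
rewrite lerD2l lerN2 ExD lerD ?Ex_small_unclosed_le // ExZ Ex_sum.
rewrite (eq_bigr (fun=> (1 + q ^+ (t + r)) ^+ n)) => [|Z /eqP Zs]; last first.
  rewrite (Ex_tr p (fun G : {set 'I_n * 'I_m} => 2 ^+ #|cononbr G Z|)).
  by rewrite Ex_cononbr_expn Zs card_ord; congr (_ ^+ _); lra.
rewrite sumr_const.
have -> : #|(fun Z : {set 'I_m} => #|Z| == (t + r)%N)| = 'C(m, t + r).
  by rewrite -[in RHS](card_ord m) -card_draws; apply: eq_card => Z; rewrite inE.
have e1 : (1 + q ^+ (t + r)) ^+ n <= expR 1.
  apply: (@le_trans _ _ (expR (n%:R * q ^+ (t + r)))); last by rewrite ler_expR.
  rewrite expRM_natl lerXn2r ?nnegrE ?expR_ge0 ?expR_ge1Dx //.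
  by rewrite addr_ge0 // exprn_ge0 // ltW.
rewrite -[in leLHS]mulr_natl.
apply: (@le_trans _ _ (c * (('C(m, t)%:R * 'C(m, r)%:R) * expR 1))).
  rewrite ler_pM2l // ler_pM //; first by rewrite exprn_ge0 // addr_ge0 // exprn_ge0 // ltW.
  by rewrite -natrM ler_nat leq_binD.
rewrite /c le_eqVlt; apply/orP; left; apply/eqP; field.
by rewrite !lt0r_neq0 // exprn_gt0.
Qed.

End Cases.

(** * Elementary growth estimates *)

Section Asymptotics.
Variable R : realType.

Lemma exists_nat_ge (x : R) : exists k : nat, x <= k%:R.
Proof.
exists (Num.bound `|x|); apply: le_trans (ler_norm x) _.
exact/ltW/archi_boundP.
Qed.

Lemma linear_le_expR (c K : R) : 0 < c ->
  exists m0 : nat, forall m : nat, (m0 <= m)%N -> K * (1 + m%:R) <= expR (c * m%:R).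
Proof.
move=> c0; have [k kE] := exists_nat_ge (4 * `|K| / c ^+ 2).
exists k.+1 => m km; have m1 : 1 <= m%:R :> R by rewrite ler1n; apply: leq_trans km.
have mK : 4 * `|K| <= c ^+ 2 * m%:R.
  rewrite [_ ^+ 2 * _]mulrC -ler_pdivrMr ?exprn_gt0 //; apply: le_trans kE _.
  by rewrite ler_nat ltnW.
apply: (@le_trans _ _ (`|K| * (1 + m%:R))).
  by rewrite ler_wpM2r ?ler_norm // addr_ge0.
apply: (@le_trans _ _ (1 + (c * m%:R) ^+ 2 / 2)); last first.
  by have := @expR_ge1Dxn R (c * m%:R) 1 (mulr_ge0 (ltW c0) (ler0n _ _)).
have := normr_ge0 K; move: `|K| mK => y; move: m%:R m1 => x; nra.
Qed.

Lemma natr_divn_le (m e : nat) : (0 < e)%N -> (m %/ e)%:R <= m%:R / e%:R :> R.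
Proof.
by move=> e0; rewrite ler_pdivlMr ?ltr0n // -natrM ler_nat leq_trunc_div.
Qed.

Lemma le_natr_divn1 (m e : nat) : (0 < e)%N -> m%:R / e%:R <= (m %/ e)%:R + 1 :> R.
Proof.
move=> e0; rewrite ler_pdivrMr ?ltr0n // natr1 -natrM ler_nat.
by rewrite ltnW // ltn_ceil.
Qed.

(** A single term of the binomial expansion gives ['C(m, r) * y ^+ r <= (1 + y) ^+ m <= expR (y *
    m)], and [y^-1 ^+ r <= expR (r / y)]. *)
Lemma bin_le_expR (m r : nat) (y : R) : 0 < y ->
  'C(m, r)%:R <= expR (y * m%:R + r%:R / y).
Proof.
move=> y0; have h : 'C(m, r)%:R * y ^+ r <= expR (y * m%:R).
  rewrite expRM_natr; apply: (@le_trans _ _ ((1 + y) ^+ m)).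
    rewrite exprDn; have [rm|mr] := leqP r m; last first.
      by rewrite bin_small // mul0r; apply: sumr_ge0 => i _;
         rewrite mulrn_wge0 // mulr_ge0 // exprn_ge0 // ltW.
    rewrite (bigD1 (Ordinal (rm : (r < m.+1)%N))) //= expr1n mul1r mulr_natl.
    rewrite lerDl; apply: sumr_ge0 => i _.
    by rewrite mulrn_wge0 // mulr_ge0 // exprn_ge0 // ltW.
  by rewrite lerXn2r ?nnegrE ?expR_ge0 ?expR_ge1Dx // addr_ge0 // ltW.
have -> : 'C(m, r)%:R = 'C(m, r)%:R * y ^+ r * y^-1 ^+ r :> R.
  by rewrite -mulrA -exprMn divff ?gt_eqF // expr1n mulr1.
have y'0 : 0 <= y^-1 by rewrite invr_ge0 ltW.
rewrite expRD expRM_natl ler_pM ?exprn_ge0 // ?mulr_ge0 ?exprn_ge0 ?(ltW y0) //.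
rewrite lerXn2r ?nnegrE ?expR_ge0 //.
by apply: le_trans (expR_ge1Dx _); rewrite lerDr.
Qed.

End Asymptotics.

(** * Large [m] and [n] at least exponential in [m] *)

Section LargeM.
Variables (R : realType) (p : R).
Hypotheses (p0 : 0 < p) (p1 : p < 1).
Local Notation q := (1 - p).

Lemma avg_left_large_m (d eps k : R) (D : nat) : 0 < d -> d <= 1 ->
  0 < eps -> 0 < k ->
  exists m0 : nat, forall m n : nat, (m0 <= m)%N -> (0 < n)%N ->
    eps < 2 * n.+1%:R ^+ D * expR (- (k * m%:R)) ->
    1 - eps <=
    bigraph_Pr p (fun G : bigraph m n => avg_left R G <= (1 / 2 + 2 * d) * m%:R).
Proof.
move=> d0 d1 e0 k0.
have q0 : 0 < q by rewrite subr_gt0.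
have qlt1 : q < 1 by rewrite gtrBl.
pose a := - ln q.
have qE i : q ^+ i = expR (- (a * i%:R)).
  by rewrite -mulNr opprK expRM_natr lnK.
have a0 : 0 < a by rewrite oppr_gt0 ln_lt0 // q0.
move: a qE a0 => a qE a0.
(* The first summand will give [2 * g <= d * m], the second [g <= s]. *)
have [u uE] := exists_nat_ge (2 / d + 2 * a * D%:R / k).
(* With y = 1 / (8 Dg), the choice r <= m / (64 Dg ^ 2) gives
   'C(m, r) <= expR (y m + r / y) <= expR (m / (4 Dg)), which is exponentially
   smaller than 2 ^ g for g about m / Dg. *)
pose Dg := u.+1; pose Dr := (64 * Dg ^ 2)%N.
have Dg0 : 0 < Dg%:R :> R by rewrite ltr0n.
have Dg1 : 2 / d <= Dg%:R.
  have : u%:R <= Dg%:R :> R by rewrite ler_nat.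
  have : 0 <= 2 * a * D%:R / k by rewrite !mulr_ge0 ?invr_ge0 // ltW.
  by move: (2 / d) (2 * a * D%:R / k) uE => x y; lra.
have Dg2 : 2 * a * D%:R / k <= Dg%:R.
  have : u%:R <= Dg%:R :> R by rewrite ler_nat.
  have : 0 <= 2 / d by rewrite !mulr_ge0 ?invr_ge0 // ltW.
  by move: (2 / d) (2 * a * D%:R / k) uE => x y; lra.
have Dr0 : (0 < Dr)%N by rewrite muln_gt0 expn_gt0.
have DrE : Dr%:R = 64 * Dg%:R ^+ 2 :> R by rewrite natrM natrX.
have DgDr : (Dg <= Dr)%N by rewrite /Dr -mulnn mulnA leq_pmull // muln_gt0.
have Dgn : (0 < Dg)%N by [].
clearbody Dr; clearbody Dg.
have DrR : 0 < Dr%:R :> R by rewrite ltr0n.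
(* Four thresholds: [m1] for the Chernoff bound on all subsets, [m2] for closedness of the sets of
   size at most [s - r], [m3] for [g <= s], [m4] for ['C(m, r)] against [2 ^ g]. *)
have [m1 H1] := @linear_le_expR R (d ^+ 2 / 8) (2 / d)
  ltac:(by rewrite divr_gt0 ?exprn_gt0).
have [m2 H2] := @linear_le_expR R (a / Dr%:R)
  ((2 + 2 / eps) / (p * expR (- (2 * a))))
  ltac:(by rewrite divr_gt0).
have [m3 H3] := @linear_le_expR R (k / 2) (2 ^+ D.+1 / eps)
  ltac:(by rewrite divr_gt0).
have [m4 H4] := @linear_le_expR R (1 / (4 * Dg%:R))
  (expR 1 / d * expR (1 / 2) / (eps / 2))
  ltac:(by rewrite divr_gt0 // mulr_gt0).
exists (Dr + m1 + m2 + m3 + m4)%N => m n mm n0 en.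
have [mDr mm1 mm2 mm3 mm4] : [/\ Dr <= m, m1 <= m, m2 <= m, m3 <= m & m4 <= m]%N.
  by clear -mm; split; lia.
have {H1 mm1}H1 := H1 m mm1.
have {H2 mm2}H2 := H2 m mm2.
have {H3 mm3}H3 := H3 m mm3.
have {H4 mm4}H4 := H4 m mm4.
pose r := (m %/ Dr)%N; pose g := (m %/ Dg)%N.
have r1 : (0 < r)%N by rewrite divn_gt0.
have rg : (r <= g)%N by rewrite leq_div2l.
have rle : r%:R <= m%:R / Dr%:R :> R by apply: natr_divn_le.
have rge : m%:R / Dr%:R <= r%:R + 1 :> R by apply: le_natr_divn1.
have gle : g%:R <= m%:R / Dg%:R :> R by apply: natr_divn_le.
have gge : m%:R / Dg%:R <= g%:R + 1 :> R by apply: le_natr_divn1.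
clearbody r g.
have M0 : 0 <= m%:R :> R by [].
have mDg : 2 * (m%:R / Dg%:R) <= d * m%:R.
  rewrite mulrA ler_pdivrMr // mulrAC ler_wpM2r //.
  by rewrite mulrC -ler_pdivrMr.
have exs : exists s : nat, n%:R * q ^+ s <= 1.
  have [s sE] := exists_nat_ge (n%:R / a); exists s.
  rewrite qE expRN ler_pdivrMr ?expR_gt0 // mul1r.
  apply: le_trans (expR_ge1Dx _); rewrite ler_pdivrMr // mulrC in sE.
  by rewrite (le_trans sE) // lerDr.
have [s sq smin] := ex_minnP exs.
(* Otherwise [n <= expR (a * s)] with [s < g] is too small for the lower bound [en]. *)
have gs : (g <= s)%N.
  rewrite leqNgt; apply/negP => sg.
  have nE : n.+1%:R <= 2 * expR (a * s%:R).
    have nE : n%:R <= expR (a * s%:R).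
      by rewrite -[leRHS]mul1r -ler_pdivrMr ?expR_gt0 // -expRN -qE.
    have : 1 <= n%:R :> R by rewrite ler1n.
    by rewrite -natr1; lra.
  have sD : a * s%:R * D%:R <= k / 2 * m%:R.
    apply: (@le_trans _ _ (a * D%:R * (m%:R / Dg%:R))).
      rewrite mulrAC ler_wpM2l ?mulr_ge0 ?(ltW a0) //.
      by rewrite (le_trans _ gle) // ler_nat ltnW.
    rewrite mulrA ler_pdivrMr // [leRHS]mulrAC ler_wpM2r //.
    by move: Dg2; rewrite ler_pdivrMr //; lra.
  have nD : n.+1%:R ^+ D <= 2 ^+ D * expR (k / 2 * m%:R).
    apply: (@le_trans _ _ ((2 * expR (a * s%:R)) ^+ D)).
      by rewrite lerXn2r ?nnegrE // mulr_ge0 ?expR_ge0.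
    by rewrite exprMn -expRM_natr ler_wpM2l ?exprn_ge0 // ler_expR.
  move: en; rewrite ltNge; move/negP; apply.
  apply: (@le_trans _ _ (2 * (2 ^+ D * expR (k / 2 * m%:R)) * expR (- (k * m%:R)))).
    by rewrite ler_wpM2r ?expR_ge0 // ler_wpM2l.
  rewrite mulrA -exprS -mulrA -expRD.
  have -> : k / 2 * m%:R + - (k * m%:R) = - (k / 2 * m%:R) by lra.
  rewrite expRN ler_pdivrMr ?expR_gt0 // mulrC -ler_pdivrMr //.
  by apply: le_trans H3; rewrite ler_peMr ?lerDl // divr_ge0 ?exprn_ge0 // ltW.
have s1 : (0 < s)%N by apply: leq_trans gs; apply: leq_trans rg.
have nq : 1 <= n%:R * q ^+ s.-1.
  by rewrite leNgt; apply/negP => /ltW/smin; rewrite -ltnS prednK // ltnn.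
(* Minimality of [s] gives [n * q ^+ s.-1 >= 1]. Going [r - 1] further below makes [n * q ^+ t]
   exponential in [m], which beats the factor [2 ^+ m * m <= expR (2 * m)]. *)
have small t : (t + r <= s)%N ->
    2 ^+ m * m%:R * expR (- (p * q ^+ t * n%:R)) <= eps / 2.
  move=> ts.
  have nqt : expR (a * (m%:R / Dr%:R - 2)) <= n%:R * q ^+ t.
    apply: (@le_trans _ _ (n%:R * q ^+ s.-1 * expR (a * (r%:R - 1)))).
      rewrite -[leLHS]mul1r; apply: ler_pM; rewrite ?expR_ge0 //.
      by rewrite ler_expR ler_wpM2l ?(ltW a0) //; lra.
    rewrite -mulrA ler_wpM2l // !qE -expRD ler_expR -mulrN -mulrN -mulrDr.
    rewrite ler_wpM2l ?(ltW a0) //.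
    have : (t + r)%:R <= s.-1%:R + 1 :> R by rewrite natr1 prednK // ler_nat.
    by rewrite natrD; lra.
  have pqt : 2 * m%:R + 2 / eps <= p * q ^+ t * n%:R.
    rewrite -mulrA [q ^+ t * _]mulrC.
    apply: (@le_trans _ _ (p * (expR (- (2 * a)) * expR (a / Dr%:R * m%:R)))); last first.
      rewrite ler_wpM2l ?(ltW p0) // (le_trans _ nqt) // -expRD ler_expR; lra.
    rewrite mulrA.
    apply: (@le_trans _ _ ((2 + 2 / eps) * (1 + m%:R))).
      have : 0 <= 2 / eps by rewrite divr_ge0 // ltW.
      by move: (2 / eps) m%:R M0 => x y; nra.
    by rewrite -ler_pdivrMl ?mulr_gt0 ?expR_gt0 // mulrA [_^-1 * _]mulrC.
  have e2 : expR (- (2 / eps)) <= eps / 2.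
    rewrite expRN -[leRHS]invrK lef_pV2 ?posrE ?expR_gt0 ?invr_gt0 ?divr_gt0 //.
    rewrite invf_div; apply: le_trans (expR_ge1Dx _); lra.
  apply: le_trans e2.
  apply: (@le_trans _ _ (expR m%:R * expR m%:R * expR (- (2 * m%:R + 2 / eps)))).
    apply: ler_pM; rewrite ?mulr_ge0 ?exprn_ge0 ?expR_ge0 //; last first.
      by rewrite ler_expR lerN2.
    apply: ler_pM; rewrite ?exprn_ge0 //.
      rewrite -[m%:R in leRHS]mulr1 expRM_natl lerXn2r ?nnegrE ?expR_ge0 //.
      by apply: le_trans (expR_ge1Dx _).
    by apply: le_trans (expR_ge1Dx _); rewrite lerDr.
  rewrite -!expRD ler_expR; lra.
(* Either all sets up to size [m./2] lie in the closed range, or [s + g <= m./2 + 2 * g], which is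
   at most [(1 / 2 + d) * m]. *)
have [hrs|shr] := leqP (m./2 + r) s.
  apply: le_trans (avg_left_huge_n n p0 p1 (ltW d0) d1 _).
    rewrite lerD2l lerN2 (le_trans (small _ hrs)) //; lra.
  rewrite expRN ler_pdivrMr ?expR_gt0 // mulrC -ler_pdivrMr //.
  by apply: le_trans H1; rewrite ler_peMr ?lerDl // divr_ge0 // ltW.
have tr : ((s - r) + r = s)%N by rewrite subnK // (leq_trans rg).
have sgm : (s + g)%:R <= (1 / 2 + d) * m%:R :> R.
  have : (s + g)%:R <= (m./2 + (g + g))%:R :> R.
    rewrite ler_nat; clear -shr rg; move: (m./2) shr rg => h; lia.
  have : 2 * m./2%:R <= m%:R :> R.
    by rewrite -natrM ler_nat mul2n -[leqRHS]odd_double_half leq_addl.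
  rewrite !natrD => h1 h2; move: (m%:R / Dg%:R) mDg gle => x; lra.
have sm : (s <= m)%N.
  rewrite -(ler_nat R).
  have : s%:R <= (m./2 + g)%:R :> R.
    rewrite ler_nat; clear -shr rg; move: (m./2) shr rg => h; lia.
  have : 2 * m./2%:R <= m%:R :> R.
    by rewrite -natrM ler_nat mul2n -[leqRHS]odd_double_half leq_addl.
  have : d * m%:R <= m%:R by rewrite ler_piMl.
  rewrite !natrD => h1 h2; move: (m%:R / Dg%:R) mDg gle => x; lra.
have := @avg_left_large_n R p m n p0 p1 d (s - r) r g d0.
rewrite tr => /(_ sm gs sgm sq); apply: le_trans.
rewrite lerD2l lerN2.
have -> : eps = eps / 2 + eps / 2 by lra.
apply: lerD; first by apply: small; rewrite tr.
have y0 : 0 < (8 * Dg%:R)^-1 :> R by rewrite invr_gt0 mulr_gt0.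
have h2 : expR (1 / 2) <= 2 :> R.
  by apply: le_trans (expR_le_quadratic _ _) _; lra.
(* From [expR (1 / 2) <= 2] and [g >= m / Dg - 1]. *)
have g2 : expR (m%:R / Dg%:R / 2 - 1 / 2) <= 2 ^+ g :> R.
  apply: (@le_trans _ _ (expR (1 / 2 : R) ^+ g)); last by rewrite lerXn2r ?nnegrE ?expR_ge0.
  rewrite -expRM_natr ler_expR; lra.
have Cb : 'C(m, r)%:R <= expR (m%:R / Dg%:R / 4) :> R.
  apply: le_trans (bin_le_expR m r y0) _; rewrite ler_expR invrK.
  have : r%:R * (8 * Dg%:R) <= m%:R / Dg%:R / 8 :> R.
    rewrite -ler_pdivlMr ?mulr_gt0 //; apply: le_trans rle _; rewrite DrE.
    by rewrite le_eqVlt; apply/orP; left; apply/eqP; field; rewrite gt_eqF.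
  have -> : (8 * Dg%:R)^-1 * m%:R = m%:R / Dg%:R / 8 :> R by field; rewrite gt_eqF.
  by move: (m%:R / Dg%:R) => x; lra.
rewrite ler_pdivrMr ?exprn_gt0 //.
apply: (@le_trans _ _ (expR 1 / d * expR (m%:R / Dg%:R / 4))).
  by rewrite ler_wpM2l // divr_ge0 ?expR_ge0 // ltW.
apply: (@le_trans _ _ (eps / 2 * expR (m%:R / Dg%:R / 2 - 1 / 2))); last first.
  by rewrite ler_wpM2l // divr_ge0 // ltW.
(* Half of the exponent cancels the bound on ['C(m, r)]; the other half absorbs the constants by
   [H4]. *)
have -> : m%:R / Dg%:R / 2 - 1 / 2 =
  m%:R / Dg%:R / 4 + 1 / (4 * Dg%:R) * m%:R - 1 / 2 :> R.
  by field; rewrite gt_eqF.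
have h4 : expR 1 / d * expR (1 / 2) <= expR (1 / (4 * Dg%:R) * m%:R) * (eps / 2).
  rewrite -ler_pdivrMr ?divr_gt0 //; apply: le_trans H4.
  by rewrite ler_peMr ?lerDl // !mulr_ge0 ?expR_ge0 ?invr_ge0 ?mulr_ge0 ?invr_ge0 // ltW.
rewrite !expRD expRN mulrA ler_pdivlMr ?expR_gt0 // mulrAC mulrC.
rewrite [leRHS]mulrCA ler_pM2l ?expR_gt0 //; apply: le_trans h4 _.
by rewrite mulrC.
Qed.

End LargeM.

(** * Combination of the ranges *)

Lemma bigraph_Pr_le (R : realType) (p : R) (m n : nat)
    (E E' : pred (bigraph m n)) : 0 <= p -> p <= 1 ->
  (forall G, E G -> E' G) -> bigraph_Pr p E <= bigraph_Pr p E'.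
Proof.
move=> p0 p1 EE'; rewrite /bigraph_Pr big_mkcond [leRHS]big_mkcond.
apply: ler_sum => G _; case: (boolP (E G)) => [/EE' ->//|_].
case: ifP => // _; apply: prodr_ge0 => uv _.
by apply: bernoulli_pmf_ge0; rewrite p0 p1.
Qed.

(** The ceiling is positive, hence some [l.+1], and [l.+1 * - ln q >= 3 * ln 2 >= 2 * ln 2]. *)
Lemma expr_ceil_logb_le (R : realType) (q : R) : 0 < q -> q < 1 ->
  exists2 l : nat, Num.ceil (3 * logb (1 / q) 2) = l.+1%:Z &
    q ^+ l.+1 <= 1 / 4.
Proof.
move=> q0 q1; have a0 : ln q < 0 by rewrite ln_lt0 // q0.
have l20 : 0 < ln 2 :> R by rewrite ln_gt0 // ltr1n.
have -> : logb (1 / q) 2 = ln 2 / - ln q by rewrite /logb div1r lnV.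
set x := 3 * _; have x0 : 0 < x by rewrite mulr_gt0 // divr_gt0 // oppr_gt0.
have : 0 < Num.ceil x by rewrite -ceil_gt0 in x0 *.
have := Num.Theory.ceil_ge x.
case: (Num.ceil x) => // -[|l] // xl _; exists l => //.
have -> : q ^+ l.+1 = expR (ln q * l.+1%:R) by rewrite expRM_natr lnK.
have -> : 1 / 4 = expR (- (2 * ln 2)) :> R.
  by rewrite expRN (expRM_natl 2) lnK ?posrE // -natrX div1r.
rewrite ler_expR.
move: xl; rewrite /x mulrA ler_pdivrMr ?oppr_gt0 // => xl.
have := xl; rewrite -[_%:~R]/(l.+1%:R); lra.
Qed.

Theorem theorem4 (R : realType) (p : R) (hp0 : 0 < p) (hp1 : p < 1) :
  let q : R := 1 - p in
  forall (delta : R) (hdelta : 0 < delta) (eps : R) (heps : 0 < eps),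
  exists N : nat, forall m n : nat,
    (0 < m)%N -> (0 < n)%N -> (N <= m + n)%N ->
    Num.max (20 : int) ((Num.ceil (3 * logb (1 / q) 2) + 2) ^+ 2) + 1
      <= (n%:Z : int) ->
    bigraph_Pr p (fun G : bigraph m n =>
        avg_left R G <= (1 / 2 + delta) * m%:R)
      >= 1 - eps.
Proof.
move=> q delta hdelta eps heps.
have q0 : 0 < q by rewrite subr_gt0.
have q1 : q < 1 by rewrite gtrBl.
have [l -> ql] := expr_ceil_logb_le q0 q1.
pose d := Num.min delta 1.
have d0 : 0 < d by rewrite lt_min hdelta ltr01.
have d1 : d <= 1 by rewrite ge_min lexx orbT.
have dd : d <= delta by rewrite ge_min lexx.
(* A common decay rate for the two failure terms of [avg_left_small_n]. *)
pose k := Num.min (d ^+ 2 / 8) (p * q ^+ l.+2).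
have k0 : 0 < k by rewrite lt_min divr_gt0 ?exprn_gt0 // mulr_gt0 ?exprn_gt0.
have mono m n c : c <= d ->
    bigraph_Pr p (fun G : bigraph m n => avg_left R G <= (1 / 2 + c) * m%:R) <=
    bigraph_Pr p (fun G : bigraph m n => avg_left R G <= (1 / 2 + delta) * m%:R).
  move=> cd; apply: bigraph_Pr_le (ltW hp0) (ltW hp1) _ => G /le_trans; apply.
  by rewrite ler_wpM2r // lerD2l (le_trans cd).
have d20 : 0 < d / 2 by rewrite divr_gt0.
have d21 : d / 2 <= 1 by rewrite ler_pdivrMr // mul1r (le_trans d1) // ler1n.
have [m0 large] := avg_left_large_m hp0 hp1 l.+3 d20 d21 heps k0.
(* For [m < m0], the condition [m0 + n0 <= m + n] forces [n0 <= n], and this [n0] makes the error of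
   [avg_left_fixed_m] at most [eps] for all such [m] at once. *)
have [n0 n0E] := exists_nat_ge (2 ^+ m0 * m0%:R / eps / (p * q ^+ m0)).
exists (m0 + n0)%N => m n m_gt0 n_gt0 mn nmax.
(* The assumed bound gives [(l + 3) ^ 2 + 1 <= n], which exceeds [3 * l + 5]. *)
have ln : (3 * l.+1 + 2 <= n)%N.
  have : (l.+1%:Z + 2) ^+ 2 + 1 <= n%:Z.
    by apply: le_trans nmax; rewrite lerD2r le_max lexx orbT.
  by clear; nia.
(* Either the error of [avg_left_small_n] is already at most [eps], or [n] is at least exponential
   in [m]. *)
have [sparse|dense] := leP (2 * n.+1%:R ^+ l.+3 * expR (- (k * m%:R))) eps.
  apply: le_trans (mono m n d (lexx d)).
  apply: le_trans (avg_left_small_n m hp0 hp1 ql (ltW d0) d1 ln (k := k) _ _).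
  - by rewrite lerD2l lerN2.
  - by rewrite ge_min lexx.
  - by rewrite ge_min lexx orbT.
have [m0m|mm0] := leqP m0 m.
  apply: le_trans (large m n m0m n_gt0 dense) (mono m n _ _).
  by rewrite mulrC divfK ?pnatr_eq0.
apply: le_trans (le_trans _ (avg_left_fixed_m m n hp0 hp1)) _; last first.
  by have := mono m n 0 (ltW d0); rewrite addr0.
rewrite lerD2l lerN2 expRN ler_pdivrMr ?expR_gt0 //.
have n0n : n0%:R <= n%:R :> R.
  by rewrite ler_nat -(leq_add2l m0) (leq_trans mn) // leq_add2r ltnW.
apply: (@le_trans _ _ (2 ^+ m0 * m0%:R)).
  by apply: ler_pM; rewrite ?exprn_ge0 ?ler_nat // ?ler_weXn2l ?ler1n // ltnW.
rewrite -ler_pdivrMl // -/q.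
apply: (@le_trans _ _ (p * q ^+ m0 * n%:R)).
  rewrite -ler_pdivrMl ?mulr_gt0 ?exprn_gt0 //.
  by apply: le_trans n0n; apply: le_trans n0E; rewrite mulrC [eps^-1 * _]mulrC.
apply: (@le_trans _ _ (p * q ^+ m * n%:R)).
  by rewrite ler_wpM2r // ler_wpM2l ?(ltW hp0) // ler_wiXn2l ?(ltW q0) ?(ltW q1) // ltnW.
by apply: le_trans (expR_ge1Dx _); rewrite lerDr.
Qed.
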